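(* Let $W,T,V$ be pairwise disjoint finite sets and let $\mathcal{M}_{WTV},\mathcal{M}_V,\mathcal{M}_T$ be matroids on $W\uplus T\uplus V$, $V$, $T$ respectively. Then $\{\mathcal{M}_{WTV},\mathcal{M}_T\oplus\mathcal{M}_V\}$ is rigid 1. iff $\{\mathcal{M}_{WTV},\mathcal{M}_V\}$ and $\{\mathcal{M}_{WTV}\leftrightarrow\mathcal{M}_V,\mathcal{M}_T\}$ are rigid; 2. iff $\{\mathcal{M}_{WTV},\mathcal{M}_V\}$ is rigid, $\{\mathcal{M}_{WTV}\wedge\mathcal{M}_V,\mathcal{M}_T\}$ satisfies the full sum property and $\{\mathcal{M}_{WTV}\vee\mathcal{M}_V,\mathcal{M}_T\}$ satisfies the zero intersection property; 3. iff $\{\mathcal{M}_{WTV},\mathcal{M}_V\}$, $\{\mathcal{M}_{WTV}\wedge\mathcal{M}_V,\mathcal{M}_T\}$ and $\{\mathcal{M}_{WTV}\vee\mathcal{M}_V,\mathcal{M}_T\}$ are rigid.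
   Context: All matroids are on finite sets; a matroid on $X\uplus Y$ carries the subscript $XY$. $\mathcal{F}_S$ is the matroid on $S$ with unique base $S$, $\mathbf{0}_S$ the matroid on $S$ with unique base $\emptyset$; $\oplus$ is direct sum; $\mathcal{M}\circ T$ is restriction to $T$ and $\mathcal{M}\times T=(\mathcal{M}^*\circ T)^*$ is contraction to $T$ (the matroid on $T$ obtained by contracting the other elements). For matroids $\mathcal{M}_1,\mathcal{M}_2$ on $S$, the union $\mathcal{M}_1\vee\mathcal{M}_2$ has as bases the maximal sets of form $b_1\cup b_2$, and $\mathcal{M}_1\wedge\mathcal{M}_2$ has as bases the minimal sets of form $b_1\cap b_2$, $b_i$ a base of $\mathcal{M}_i$ (so $(\mathcal{M}_1\vee\mathcal{M}_2)^*=\mathcal{M}_1^*\wedge\mathcal{M}_2^*$). For pairwise disjoint $S,P,Q$ (possibly empty): $\mathcal{M}_{SP}\vee\mathcal{M}_{PQ}=(\mathcal{M}_{SP}\oplus\mathbf{0}_Q)\vee(\mathcal{M}_{PQ}\oplus\mathbf{0}_S)$, $\mathcal{M}_{SP}\wedge\mathcal{M}_{PQ}=(\mathcal{M}_{SP}\oplus\mathcal{F}_Q)\wedge(\mathcal{M}_{PQ}\oplus\mathcal{F}_S)$, and $\mathcal{M}_{SP}\leftrightarrow\mathcal{M}_{PQ}=(\mathcal{M}_{SP}\vee\mathcal{M}_{PQ})\times(S\uplus Q)$. For pairwise disjoint $A,B,C$ (possibly empty), a pair $\{\mathcal{M}_{AB},\mathcal{M}_{BC}\}$ has the full sum property iff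 $\mathcal{M}_{AB}\circ B\vee\mathcal{M}_{BC}\circ B=\mathcal{F}_B$, the zero intersection property iff $\mathcal{M}_{AB}\times B\wedge\mathcal{M}_{BC}\times B=\mathbf{0}_B$, and is rigid iff it has both (when $B=\emptyset$ it is taken to be rigid). *)

(* Defs.v *)
From mathcomp Require Import all_boot.
Set Implicit Arguments.
Unset Strict Implicit.
Unset Printing Implicit Defensive.

(* Ground sets are subsets of an ambient finite type U.  The operations below
   are defined on arbitrary families of bases; [is_matroid] singles out the
   families satisfying the basis axioms. *)
Record base_system (U : finType) : Type := BaseSystem {
  ground : {set U};
  bases : {set {set U}}
}.

Section Matroids.

Variable U : finType.
Implicit Types (M N : base_system U) (S B X : {set U}).

Definition is_matroid M : Prop :=
  [/\ bases M != set0,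
      forall b, b \in bases M -> b \subset ground M
    & forall b1 b2 x, b1 \in bases M -> b2 \in bases M -> x \in b1 :\: b2 ->
        exists2 y, y \in b2 :\: b1 & y |: (b1 :\ x) \in bases M].

Definition indep M X : bool := [exists b in bases M, X \subset b].

Definition free_matroid S : base_system U := BaseSystem S [set S].

Definition zero_matroid S : base_system U := BaseSystem S [set set0].

Definition dual M : base_system U :=
  BaseSystem (ground M) [set ground M :\: b | b in bases M].

(* Meant for S \subset ground M, as is [contract]. *)
Definition restrict M S : base_system U :=
  BaseSystem S [set X | maxset [pred Y : {set U} | (Y \subset S) && indep M Y] X].

(* S is the set of elements kept, not the set of elements contracted. *)
Definition contract M S : base_system U := dual (restrict (dual M) S).

(* Meant for disjoint ground sets. *)
Definition direct_sum M N : base_system U :=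
  BaseSystem (ground M :|: ground N)
    [set b1 :|: b2 | b1 in bases M, b2 in bases N].

(* Union and its dual operation for matroids on one and the same ground set. *)
Definition union_same M N : base_system U :=
  BaseSystem (ground M)
    [set X | maxset (fun Y => Y \in [set b1 :|: b2 | b1 in bases M, b2 in bases N]) X].

Definition inter_same M N : base_system U :=
  BaseSystem (ground M)
    [set X | minset (fun Y => Y \in [set b1 :&: b2 | b1 in bases M, b2 in bases N]) X].

(* M on S + P and N on P + Q, with P the intersection of the ground sets:
   S = ground M :\: ground N and Q = ground N :\: ground M. *)
Definition mvee M N : base_system U :=
  union_same (direct_sum M (zero_matroid (ground N :\: ground M)))
             (direct_sum N (zero_matroid (ground M :\: ground N))).

Definition mwedge M N : base_system U :=
  inter_same (direct_sum M (free_matroid (ground N :\: ground M)))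
             (direct_sum N (free_matroid (ground M :\: ground N))).

Definition link M N : base_system U :=
  contract (mvee M N)
    ((ground M :\: ground N) :|: (ground N :\: ground M)).

Definition full_sum M N : Prop :=
  let B := ground M :&: ground N in
  union_same (restrict M B) (restrict N B) = free_matroid B.

Definition zero_intersection M N : Prop :=
  let B := ground M :&: ground N in
  inter_same (contract M B) (contract N B) = zero_matroid B.

Definition rigid M N : Prop :=
  ground M :&: ground N = set0 \/ (full_sum M N /\ zero_intersection M N).

End Matroids.

(* Main.v *)
Require Import Defs.
From Corelib Require Import Setoid.
From mathcomp Require Import all_boot.

Set Implicit Arguments.
Unset Strict Implicit.
Unset Printing Implicit Defensive.

(** Write M, N, K for the matroids on W + T + V, V and T.

    Both properties are existential statements about bases: the full sum
    property of M and N says that some base of M and some base of N together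
    cover the common ground set ([full_sumP]), and the zero intersection property
    says that some base of M and some base of N share no element of it
    ([zero_intersectionP]).  Passing to complements of bases exchanges the two
    ([full_sum_dual], [zero_intersection_dual]), exchanges union and
    intersection ([mwedge_dual]) and commutes with direct sums
    ([dual_direct_sum]), so each fact about one property gives the same fact about
    the other.

    A pair of bases of M and K + N witnessing one of the properties for M and
    K + N contains a pair of bases witnessing it for M and N.  Assume
    therefore that M and N have the zero intersection property.  Then some b + n
    with b a base of M and n a base of N is a disjoint union, and by
    equicardinality of the bases of the union matroid every base of that matroid
    splits in this way ([mvee_base_disjoint]).  So a base of the union of M and N
    meeting a base k of K nowhere is the same thing as a base b disjoint from a
    base k + n of K + N: this is [zero_intersection_mvee], whose dual is
    [full_sum_mwedge].  Together these give the criterion through union and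
    intersection.

    For the link, which is a contraction of the union matroid to the complement
    of V, the zero intersection property with K is unaffected by the contraction
    ([zero_intersection_contract]), since bases of a contraction are the minimal
    traces of bases.  The full sum property of M and N says that V is
    independent in the union matroid, so the bases of the link are the traces of
    those bases of the union matroid that contain V ([contract_indep_base]), whence
    [full_sum_link].  Finally the two properties by which full rigidity of the
    union and intersection pairs exceeds that criterion follow at once from
    b + n lying in a base of the union matroid ([full_sum_mvee]) and its dual.

    The matroid theory needed is that M v N is a matroid ([mvee_matroid]): its
    independent sets, the subsets of unions of bases, have the augmentation
    property ([union_augment]). *)

(** Set identities and inclusions hold pointwise, by truth table on the
    membership of [x]; hypotheses take part once they are reverted in boolean
    form, inclusions and disjointness as [==>]. *)
Ltac by_membership x :=
  rewrite ?inE;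
  repeat match goal with |- context [x \in ?A] => case: (x \in A) end;
  by [].

Section MatroidTheory.

Variable U : finType.
Implicit Types (M N K : base_system U) (S B I J X Y b : {set U}).

(** * Bases and independent sets *)

Lemma subset_implyb x X Y : X \subset Y -> (x \in X) ==> (x \in Y).
Proof. by move=> /subsetP sXY; apply/implyP/sXY. Qed.

Lemma disjoint_implyb x X Y : [disjoint X & Y] -> (x \in X) ==> (x \notin Y).
Proof. by move=> dXY; apply/implyP => xX; rewrite (disjointFr dXY). Qed.

Lemma indepP M X :
  reflect (exists2 b, b \in bases M & X \subset b) (indep M X).
Proof. exact: exists_inP. Qed.

Lemma base_indep M b : b \in bases M -> indep M b.
Proof. by move=> bM; apply/indepP; exists b. Qed.

Lemma indepS M X Y : X \subset Y -> indep M Y -> indep M X.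
Proof.
by move=> sXY /indepP[b bM sYb]; apply/indepP; exists b; rewrite ?(subset_trans sXY).
Qed.

Lemma card_swap b x y : x \in b -> y \notin b -> #|y |: (b :\ x)| = #|b|.
Proof.
by move=> xb ynb; rewrite cardsU1 !inE (negbTE ynb) andbF (cardsD1 x b) xb.
Qed.

(** Exchanging an element of b1 that is outside b2 keeps the size of b1 and
    brings it closer to b2, until b1 is contained in b2; then a further element
    of b2 could not be exchanged. *)
Lemma card_bases M b1 b2 :
  is_matroid M -> b1 \in bases M -> b2 \in bases M -> #|b1| = #|b2|.
Proof.
move=> [_ _ exch] b1M b2M.
have [n] := ubnP #|b1 :\: b2|; elim: n b1 b1M => // n IHn b1 b1M ltn.
have [b1D|[x xD]] := set_0Vmem (b1 :\: b2).
  have sb12 : b1 \subset b2 by rewrite -setD_eq0 b1D.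
  suff -> : b1 = b2 by [].
  apply/setP => z; apply/idP/idP => [|zb2]; first exact: (subsetP sb12).
  apply/negPn/negP => znb1.
  have [|y] := exch b2 b1 z b2M b1M; first by rewrite inE znb1.
  by rewrite b1D inE.
have [y yD b3M] := exch _ _ _ b1M b2M xD.
move: xD yD; rewrite !inE => /andP[xnb2 xb1] /andP[ynb1 yb2].
rewrite -(card_swap xb1 ynb1); apply: IHn b3M _.
rewrite -ltnS (leq_trans _ ltn) // ltnS; apply: proper_card; apply/properP; split.
  apply/subsetP => z; rewrite !inE => /andP[znb2].
  by case/orP => [/eqP ezy|/andP[_ ->]]; [rewrite ezy yb2 in znb2|rewrite znb2].
by exists x; rewrite !inE ?xb1 ?xnb2 // eqxx /= orbF; apply/negP => /eqP e;
  rewrite e yb2 in xnb2.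
Qed.

(** Among the bases containing I, one with fewest elements outside [I :|: b] has
    none: such an element could be exchanged for an element of b. *)
Lemma base_extend M I b :
  is_matroid M -> indep M I -> b \in bases M ->
  exists b', [/\ b' \in bases M, I \subset b' & b' \subset I :|: b].
Proof.
move=> [_ _ exch] /indepP[b0 b0M sIb0] bM.
have P0 : (b0 \in bases M) && (I \subset b0) by rewrite b0M.
case: (@arg_minnP _ _ (fun c : {set U} => (c \in bases M) && (I \subset c))
  (fun c => #|c :\: (I :|: b)|) P0) => b' /andP[b'M sIb'] min_b'.
exists b'; split=> //; rewrite -setD_eq0; apply/eqP.
have [//|[x xD]] := set_0Vmem (b' :\: (I :|: b)).
move: (xD); rewrite !inE negb_or => /andP[/andP[xnI xnb] xb'].
have [|y yD b3M] := exch _ _ x b'M bM; first by rewrite inE xnb.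
move: yD; rewrite inE => /andP[ynb' yb].
have /min_b' : (y |: (b' :\ x) \in bases M) && (I \subset y |: (b' :\ x)).
  rewrite b3M; apply/subsetP => z zI; rewrite !inE (subsetP sIb') // andbT.
  by apply/orP; right; apply: contraNneq xnI => <-.
rewrite leqNgt proper_card //; apply/properP; split.
  apply/subsetP => z; rewrite !inE => /andP[znIb].
  by case/orP => [/eqP ezy|/andP[_ ->]]; [rewrite ezy yb orbT in znIb|rewrite znIb].
exists x => //; rewrite !inE eqxx /= orbF negb_and; apply/orP; right.
by apply: contraNneq xnb => ->.
Qed.

Definition augmentable M :=
  forall I J, indep M I -> indep M J -> #|I| < #|J| ->
    exists2 x, x \in J :\: I & indep M (x |: I).

(** Extend I by elements of a base b containing J.  If the result misses
    [J :\: I], it lies in [I :|: (b :\: J)], which is smaller than b when J is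
    larger than I. *)
Lemma matroid_augmentable M : is_matroid M -> augmentable M.
Proof.
move=> matM I J indI /indepP[b bM sJb] ltIJ.
have [b' [b'M sIb' sb'I]] := base_extend matM indI bM.
have [disj|[x]] := set_0Vmem (b' :&: (J :\: I)); last first.
  rewrite inE => /andP[xb' xJI]; exists x => //.
  by apply/indepP; exists b'; rewrite // subUset sub1set xb'.
have: b' \subset I :|: (b :\: J).
  apply/subsetP => z zb'; move: (subsetP sb'I z zb') (in_set0 z); rewrite -disj.
  by move: zb'; by_membership z.
move/subset_leq_card; rewrite (card_bases matM b'M bM) => le_b.
have := leq_trans le_b (leq_card_setU _ _).
by rewrite cardsD (setIidPr sJb) leqNgt -(subnKC (subset_leq_card sJb)) addKn ltn_add2r ltIJ.
Qed.

(** The antichain condition and augmentation make every base an independent set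
    of maximal size; base exchange is then the augmentation of [b1 :\ x] from b2. *)
Lemma augmentable_matroid M :
  bases M != set0 -> (forall b, b \in bases M -> b \subset ground M) ->
  (forall b1 b2, b1 \in bases M -> b2 \in bases M -> b1 \subset b2 -> b1 = b2) ->
  augmentable M -> is_matroid M.
Proof.
move=> bM0 sbM anti aug.
have le_card b I : b \in bases M -> indep M I -> #|I| <= #|b|.
  move=> bM indI; rewrite leqNgt; apply/negP => lt_b.
  have [x] := aug _ _ (base_indep bM) indI lt_b.
  rewrite inE => /andP[xnb _] /indepP[b' b'M]; rewrite subUset sub1set => /andP[xb' sbb'].
  by rewrite (anti _ _ bM b'M sbb') xb' in xnb.
split=> // b1 b2 x b1M b2M; rewrite inE => /andP[xnb2 xb1].
have lt_b2 : #|b1 :\ x| < #|b2|.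
  by rewrite (leq_trans _ (le_card _ _ b2M (base_indep b1M))) // (cardsD1 x b1) xb1.
have [|y] := aug _ _ _ (base_indep b2M) lt_b2.
  exact: indepS (subD1set _ _) (base_indep b1M).
rewrite !inE negb_and negbK => /andP[ynb1 yb2] /indepP[b3 b3M sb3].
have {}ynb1 : y \notin b1.
  by case/orP: ynb1 => // /eqP eyx; rewrite -eyx yb2 in xnb2.
exists y; first by rewrite inE ynb1.
suff /eqP -> : y |: b1 :\ x == b3 by [].
by rewrite eqEcard sb3 card_swap // le_card // base_indep.
Qed.

(** * Duality *)

Lemma dualK M : (forall b, b \in bases M -> b \subset ground M) -> dual (dual M) = M.
Proof.
case: M => S F /= sFS; rewrite /dual /=; congr BaseSystem.
have cK b : b \in F -> S :\: (S :\: b) = b.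
  by move=> /sFS sbS; rewrite setDDr setDv set0U (setIidPr sbS).
apply/setP => X; apply/imsetP/idP => [[_ /imsetP[b bF ->] ->]|XF].
  by rewrite cK.
by exists (S :\: X); rewrite ?cK // imset_f.
Qed.

(** Exchange for complements asks to add to b1 a given x of b2 and remove some y
    outside b2: extending [x |: (b1 :&: b2)] inside [x |: b1] leaves out exactly
    one element of b1, and it is not in b2. *)
Lemma dual_matroid M : is_matroid M -> is_matroid (dual M).
Proof.
move=> matM; have [bM0 sbM _] := matM; split=> /=.
- by have /set0Pn[b bM] := bM0; apply/set0Pn; exists (ground M :\: b); rewrite imset_f.
- by move=> _ /imsetP[b _ ->]; rewrite subsetDl.
move=> _ _ x /imsetP[b1 b1M ->] /imsetP[b2 b2M ->] xD.
have [xb2 xnb1 xE] : [/\ x \in b2, x \notin b1 & x \in ground M].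
  by move: xD; by_membership x.
have ind : indep M (x |: (b1 :&: b2)).
  by apply/indepP; exists b2; rewrite // subUset sub1set xb2 subsetIr.
have [b3 [b3M sb3 s3b]] := base_extend matM ind b1M.
have xb3 : x \in b3 by apply: (subsetP sb3); rewrite !inE eqxx.
have eqc := card_bases matM b3M b1M.
have [s13|[y]] := set_0Vmem (b1 :\: b3).
  have /eqP e : b1 == b3 by rewrite eqEcard -setD_eq0 s13 eqxx eqc /=.
  by rewrite e xb3 in xnb1.
rewrite inE => /andP[ynb3 yb1].
have ynb2 : y \notin b2.
  apply: contra ynb3 => yb2; apply: (subsetP sb3).
  by rewrite !inE yb1 yb2 orbT.
have yE := subsetP (sbM _ b1M) y yb1.
exists y; first by rewrite !inE ynb2 yb1 yE.
have nxy : x != y by apply: contraNneq xnb1 => ->.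
suff -> : y |: (ground M :\: b1) :\ x = ground M :\: b3 by rewrite imset_f.
have /eqP -> : b3 == x |: (b1 :\ y).
  rewrite eqEcard card_swap // eqc leqnn andbT; apply/subsetP => z zb3.
  move: (subsetP s3b z zb3); rewrite !inE; case: eqP => //= _ .
  have [ezy|_] := eqVneq z y; first by rewrite ezy (negbTE ynb3) in zb3.
  by case: (z \in b1).
apply/setP => z; rewrite !inE.
have [->|nzy] := eqVneq z y; first by rewrite eq_sym (negbTE nxy) yE.
by have [->|] := eqVneq z x; rewrite //=.
Qed.

Lemma dual_direct_sum M N :
  is_matroid M -> is_matroid N -> [disjoint ground M & ground N] ->
  dual (direct_sum M N) = direct_sum (dual M) (dual N).
Proof.
move=> [_ sM _] [_ sN _] dMN; rewrite /dual /direct_sum /=; congr BaseSystem.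
have split_compl b1 b2 : b1 \in bases M -> b2 \in bases N ->
    (ground M :|: ground N) :\: (b1 :|: b2)
      = (ground M :\: b1) :|: (ground N :\: b2).
  move=> /sM s1 /sN s2; apply/setP => x.
  by move: (subset_implyb x s1) (subset_implyb x s2) (disjoint_implyb x dMN); by_membership x.
apply/setP => X; apply/imsetP/imset2P => [[_ /imset2P[b1 b2 b1M b2N ->] ->]|].
  by exists (ground M :\: b1) (ground N :\: b2); rewrite ?imset_f ?split_compl.
case=> _ _ /imsetP[b1 b1M ->] /imsetP[b2 b2N ->] ->.
by exists (b1 :|: b2); rewrite ?split_compl ?imset2_f.
Qed.

(** * Matroid union *)

Lemma bases_direct_sum_zero M S : bases (direct_sum M (zero_matroid S)) = bases M.
Proof.
apply/setP => X; apply/imset2P/idP => [[b e bM /set1P -> ->]|XM].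
  by rewrite setU0.
by exists X set0; rewrite ?setU0 ?inE.
Qed.

Lemma bases_mvee M N :
  bases (mvee M N)
    = [set X | maxset (fun Y => Y \in [set b1 :|: b2 | b1 in bases M, b2 in bases N]) X].
Proof. by apply/setP => X; rewrite /mvee /union_same !inE !bases_direct_sum_zero. Qed.

Lemma mvee_baseP M N X :
  reflect (maxset (fun Y => Y \in [set b1 :|: b2 | b1 in bases M, b2 in bases N]) X)
          (X \in bases (mvee M N)).
Proof. by rewrite bases_mvee inE; apply: idP. Qed.

Lemma ground_mvee M N : ground (mvee M N) = ground M :|: ground N.
Proof. by apply/setP => x /=; by_membership x. Qed.

Lemma mvee_base_split M N X : X \in bases (mvee M N) ->
  exists b1 b2, [/\ b1 \in bases M, b2 \in bases N & X = b1 :|: b2].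
Proof. by move=> /mvee_baseP/maxsetp/imset2P[b1 b2 ? ? ->]; exists b1, b2. Qed.

Lemma indep_mveeP M N X :
  reflect (exists b1 b2, [/\ b1 \in bases M, b2 \in bases N & X \subset b1 :|: b2])
          (indep (mvee M N) X).
Proof.
apply: (iffP (indepP _ _)) => [[c /mvee_base_split[b1 [b2 [? ? ->]]] sX]|].
  by exists b1, b2.
case=> b1 [b2 [b1M b2N sX]].
have [c cmax sc] := @maxset_exists _
  (fun Y => Y \in [set b1 :|: b2 | b1 in bases M, b2 in bases N])
  (b1 :|: b2) (imset2_f _ b1M b2N).
by exists c; [apply/mvee_baseP|apply: subset_trans sc].
Qed.

(** Some [I_i] is smaller than [J_i]; augment it by an x of [J_i].  Either x is
    new in the union, or x can be moved from the other part of I to this one,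
    which keeps the union and brings the pair (I1, I2) closer to (J1, J2).
    Disjointness of J1 and J2 ensures that removing x from the other part does
    not spoil the progress there. *)
Lemma union_augment M N I1 I2 J1 J2 :
  is_matroid M -> is_matroid N ->
  indep M I1 -> indep N I2 -> indep M J1 -> indep N J2 ->
  [disjoint J1 & J2] -> #|I1| + #|I2| < #|J1| + #|J2| ->
  exists2 x, x \in (J1 :|: J2) :\: (I1 :|: I2) &
    exists I1' I2', [/\ indep M I1', indep N I2' & x |: (I1 :|: I2) = I1' :|: I2'].
Proof.
have [n] := ubnP (#|J1 :\: I1| + #|J2 :\: I2|).
elim: n M N I1 I2 J1 J2 => // n IHn M N I1 I2 J1 J2 ltn matM matN iI1 iI2 iJ1 iJ2 dJ ltIJ.
(* Swapping the two matroids is harmless since the statement is symmetric. *)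
wlog lt1 : M N I1 I2 J1 J2 ltn matM matN iI1 iI2 iJ1 iJ2 dJ ltIJ / #|I1| < #|J1|.
  move=> base; have [lt1|le1] := ltnP #|I1| #|J1|; first exact: base lt1.
  have lt2 : #|I2| < #|J2|.
    by rewrite ltnNge; apply: contraL ltIJ => le2; rewrite -leqNgt leq_add.
  have [|||x xD [I2' [I1' [? ? eI]]]] :=
    base N M I2 I1 J2 J1 _ matN matM iI2 iI1 iJ2 iJ1 _ _ lt2.
  - by rewrite addnC.
  - by rewrite disjoint_sym.
  - by rewrite addnC [ltnRHS]addnC.
  exists x; first by rewrite setUC [I1 :|: I2]setUC.
  by exists I1', I2'; rewrite [I1 :|: I2]setUC eI [RHS]setUC.
have [x] := matroid_augmentable matM iI1 iJ1 lt1.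
rewrite inE => /andP[xnI1 xJ1] iI1x.
have xnJ2 : x \notin J2 by rewrite (disjointFr dJ).
have [xI2|xnI2] := boolP (x \in I2); last first.
  exists x; first by rewrite !inE xJ1 negb_or xnI1 xnI2.
  by exists (x |: I1), I2; rewrite setUA.
have eU : (x |: I1) :|: (I2 :\ x) = I1 :|: I2.
  by rewrite setUAC setUC setD1K // setUC.
rewrite -eU; apply: IHn => //.
- rewrite -ltnS (leq_trans _ ltn) // ltnS -addSn leq_add //.
    apply: proper_card; apply/properP; split.
      by apply: setDS; apply: subsetUr.
    by exists x; rewrite !inE ?eqxx ?xnI1.
  apply: subset_leq_card; apply/subsetP => z; rewrite !inE.
  by case: eqP => [->|_] /=; rewrite ?(negbTE xnJ2) ?andbF.
- by apply: indepS iI2; apply: subD1set.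
- by rewrite cardsU1 xnI1 [1 + _]addnC -addnA -[1]/(true : nat) -xI2 -cardsD1.
Qed.

Lemma mvee_augmentable M N :
  is_matroid M -> is_matroid N -> augmentable (mvee M N).
Proof.
move=> matM matN I J /indep_mveeP[b1 [b2 [b1M b2N sI]]] /indep_mveeP[c1 [c2 [c1M c2N sJ]]] ltIJ.
(* Cut X into disjoint parts, so that their sizes add up to that of X. *)
have cut X a1 a2 : a1 \in bases M -> a2 \in bases N -> X \subset a1 :|: a2 ->
    indep M (X :&: a1) /\ indep N (X :\: a1).
  move=> a1M a2N sX; split; apply/indepP; first by exists a1; rewrite ?subsetIr.
  exists a2 => //; apply/subsetP => z; rewrite inE => /andP[zna1 zX].
  by have := subsetP sX z zX; rewrite inE (negbTE zna1).
have [iI1 iI2] := cut _ _ _ b1M b2N sI; have [iJ1 iJ2] := cut _ _ _ c1M c2N sJ.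
have [||x xD [I1' [I2' [/indepP[a1 ? s1] /indepP[a2 ? s2] eI]]]] :=
    union_augment matM matN iI1 iI2 iJ1 iJ2.
- by rewrite -setI_eq0; apply/eqP/setP => z; by_membership z.
- by rewrite !cardsID.
rewrite !setID in xD eI; exists x => //; apply/indep_mveeP; exists a1, a2; split=> //.
by rewrite eI setUSS.
Qed.

Lemma mvee_matroid M N :
  is_matroid M -> is_matroid N -> is_matroid (mvee M N).
Proof.
move=> matM matN; have [bM0 sM _] := matM; have [bN0 sN _] := matN.
apply: augmentable_matroid (mvee_augmentable matM matN).
- have [/set0Pn[b1 b1M] /set0Pn[b2 b2N]] := (bM0, bN0).
  have /indepP[c cMN _] : indep (mvee M N) set0.
    by apply/indep_mveeP; exists b1, b2; rewrite sub0set.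
  by apply/set0Pn; exists c.
- by move=> _ /mvee_base_split[b1 [b2 [b1M b2N ->]]]; rewrite ground_mvee setUSS ?sM ?sN.
- by move=> b1 b2 /mvee_baseP/maxsetP[_ max1] /mvee_baseP/maxsetp b2P s12; rewrite (max1 b2).
Qed.

(** * Restriction, contraction and the two properties in terms of bases *)

(** Lets the independent sets in the definition of restriction be replaced by the
    traces of bases. *)
Lemma maxset_cofinal (P Q : pred {set U}) X :
  (forall Y, P Y -> Q Y) -> (forall Y, Q Y -> exists2 Z, P Z & Y \subset Z) ->
  maxset P X = maxset Q X.
Proof.
move=> PQ QP; apply/maxsetP/maxsetP => [[PX maxX]|[QX maxX]].
  split=> [|Y QY sXY]; first exact: PQ.
  have [Z PZ sYZ] := QP Y QY.
  by apply/eqP; rewrite eqEsubset sXY andbT -(maxX Z) ?(subset_trans sXY).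
split=> [|Y PY]; last by apply: maxX; apply: PQ.
by have [Z PZ sXZ] := QP X QX; rewrite -(maxX Z (PQ _ PZ) sXZ).
Qed.

(** Transfers maximality to minimality in the dual constructions, both contraction
    and the intersection of matroids. *)
Lemma minset_complements S (F : {set {set U}}) :
  (forall Y, Y \in F -> Y \subset S) ->
  [set X | minset (fun Y => Y \in F) X]
    = [set S :\: Z | Z in [set Z | maxset (fun Y => Y \in [set S :\: Y | Y in F]) Z]].
Proof.
move=> sFS; have cK Y : Y \in F -> S :\: (S :\: Y) = Y.
  by move=> /sFS sYS; rewrite setDDr setDv set0U (setIidPr sYS).
apply/setP => X; rewrite inE; apply/minsetP/imsetP => [[XF minX]|[Z]].
  exists (S :\: X); last by rewrite cK.
  rewrite inE; apply/maxsetP; split=> [|_ /imsetP[Y YF ->] sXY]; first exact: imset_f.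
  by rewrite (minX Y) // -(cK X) // -(cK Y) // setDS.
rewrite inE => /maxsetP[/imsetP[Y YF ->] maxY] ->; rewrite cK //.
split=> // Y' Y'F sY'Y; rewrite -(cK Y') // -[RHS]cK //.
by rewrite (maxY (S :\: Y')) ?imset_f ?setDS.
Qed.

Lemma bases_restrict M S :
  bases (restrict M S)
    = [set X | maxset (fun Y => Y \in [set b :&: S | b in bases M]) X].
Proof.
apply/setP => X; rewrite !inE; apply/esym/maxset_cofinal => [_ /imsetP[b bM ->]|Y] /=.
  by rewrite subsetIr; apply/indepP; exists b; rewrite ?subsetIl.
case/andP=> sYS /indepP[b bM sYb]; exists (b :&: S); first exact: imset_f.
by rewrite subsetI sYb.
Qed.

Lemma bases_contract M S : S \subset ground M ->
  bases (contract M S)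
    = [set X | minset (fun Y => Y \in [set b :&: S | b in bases M]) X].
Proof.
move=> sSM; rewrite (@minset_complements S) => [|_ /imsetP[b _ ->]]; last exact: subsetIr.
transitivity [set S :\: b | b in bases (restrict (dual M) S)]; first by [].
rewrite bases_restrict.
suff -> : [set b :&: S | b in bases (dual M)]
    = [set S :\: Y | Y in [set b :&: S | b in bases M]] by [].
rewrite /= -!imset_comp; apply: eq_imset => b /=.
apply/setP => x; move: (subsetP sSM x); rewrite !inE.
by case: (x \in S) => [->|_]; rewrite ?andbT ?andbF.
Qed.

Lemma contract_below M S b : S \subset ground M -> b \in bases M ->
  exists2 d, d \in bases (contract M S) & d \subset b :&: S.
Proof.
move=> sSM bM; have [d dmin sd] := @minset_exists _
  (fun Y => Y \in [set b :&: S | b in bases M]) _ (imset_f _ bM).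
by exists d; rewrite ?bases_contract ?inE.
Qed.

Lemma contract_base_trace M S d : S \subset ground M ->
  d \in bases (contract M S) -> exists2 b, b \in bases M & d = b :&: S.
Proof.
by move=> sSM; rewrite bases_contract // inE => /minsetp/imsetP[b bM ->]; exists b.
Qed.

Lemma full_sumP M N :
  full_sum M N <-> exists b1 b2,
    [/\ b1 \in bases M, b2 \in bases N & ground M :&: ground N \subset b1 :|: b2].
Proof.
rewrite /full_sum /union_same /free_matroid !bases_restrict.
set S := ground M :&: ground N.
set F1 := [set X | maxset (fun Y => Y \in [set b :&: S | b in bases M]) X].
set F2 := [set X | maxset (fun Y => Y \in [set b :&: S | b in bases N]) X].
split=> [[/setP/(_ S)]|[b1 [b2 [b1M b2N sS]]]].
  rewrite !inE eqxx => /maxsetp/imset2P[X1 X2].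
  rewrite !inE => /maxsetp/imsetP[b1 b1M ->] /maxsetp/imsetP[b2 b2N ->] eS.
  by exists b1, b2; split; rewrite // eS setUSS // subsetIl.
have inF : S \in [set X1 :|: X2 | X1 in F1, X2 in F2].
  have [X1 max1 s1] := @maxset_exists _
    (fun Y => Y \in [set b :&: S | b in bases M]) _ (imset_f _ b1M).
  have [X2 max2 s2] := @maxset_exists _
    (fun Y => Y \in [set b :&: S | b in bases N]) _ (imset_f _ b2N).
  apply/imset2P; exists X1 X2; rewrite ?inE //; apply/eqP; rewrite eqEsubset.
  rewrite -{1}(setIidPr sS) setIUl setUSS //= subUset.
  have /imsetP[? _ ->] := maxsetp max1; have /imsetP[? _ ->] := maxsetp max2.
  by rewrite !subsetIr.
have leS X : X \in [set X1 :|: X2 | X1 in F1, X2 in F2] -> X \subset S.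
  case/imset2P=> X1 X2; rewrite !inE => /maxsetp/imsetP[? _ ->] /maxsetp/imsetP[? _ ->] ->.
  by rewrite subUset !subsetIr.
congr BaseSystem; apply/setP => X; rewrite !inE; apply/idP/eqP => [/maxsetP[XF maxX]|->].
  by rewrite -(maxX S) ?leS.
by apply/maxsetP; split=> // Y YF sSY; apply/eqP; rewrite eqEsubset leS.
Qed.

Lemma zero_intersectionP M N :
  zero_intersection M N <-> exists b1 b2,
    [/\ b1 \in bases M, b2 \in bases N & [disjoint ground M :&: ground N & b1 :&: b2]].
Proof.
rewrite /zero_intersection /inter_same /zero_matroid.
set S := ground M :&: ground N.
have [sM sN] : S \subset ground M /\ S \subset ground N by rewrite subsetIl subsetIr.
split=> [[/setP/(_ set0)]|[b1 [b2 [b1M b2N dS]]]].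
  rewrite !inE eqxx => /minsetp/imset2P[X1 X2].
  case/(contract_base_trace sM)=> b1 b1M -> /(contract_base_trace sN)[b2 b2N ->] /esym eS.
  exists b1, b2; split=> //; rewrite -setI_eq0 -eS; apply/eqP/setP => x; by_membership x.
have inF : set0 \in [set X1 :&: X2 | X1 in bases (contract M S), X2 in bases (contract N S)].
  have [X1 X1M s1] := contract_below sM b1M; have [X2 X2N s2] := contract_below sN b2N.
  apply/imset2P; exists X1 X2 => //; apply/esym/eqP; rewrite -subset0.
  rewrite (subset_trans (setISS s1 s2)) // subset0 -setIIl setI_eq0.
  by rewrite disjoint_sym.
congr BaseSystem; apply/setP => X; rewrite !inE; apply/idP/eqP => [/minsetP[XF minX]|->].
  by rewrite -(minX set0) ?sub0set.
by apply/minsetP; split=> // Y YF; rewrite subset0 => /eqP.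
Qed.

(** The convention for disjoint ground sets agrees with the general case as soon as
    bases exist. *)
Lemma rigidP M N : bases M != set0 -> bases N != set0 ->
  rigid M N <-> full_sum M N /\ zero_intersection M N.
Proof.
move=> /set0Pn[b1 b1M] /set0Pn[b2 b2N]; split=> [[e|//]|]; last by right.
by split; [apply/full_sumP|apply/zero_intersectionP]; exists b1, b2;
  rewrite e ?sub0set // -setI_eq0 set0I.
Qed.

Lemma full_sum_dual M N : full_sum M N <-> zero_intersection (dual M) (dual N).
Proof.
rewrite full_sumP zero_intersectionP; split=> [[b1 [b2 [b1M b2N sS]]]|].
  exists (ground M :\: b1), (ground N :\: b2); rewrite !imset_f // -setI_eq0 /=.
  split=> //; apply/eqP/setP => x; move: (subset_implyb x sS); by_membership x.
case=> _ [_ [/imsetP[b1 b1M ->] /imsetP[b2 b2N ->]]].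
rewrite -setI_eq0 /= => /eqP/setP dS; exists b1, b2; split=> //.
by apply/subsetP => x; apply/implyP; move: (dS x); by_membership x.
Qed.

Lemma zero_intersection_dual M N : zero_intersection M N <-> full_sum (dual M) (dual N).
Proof.
rewrite full_sumP zero_intersectionP; split=> [[b1 [b2 [b1M b2N]]]|].
  rewrite -setI_eq0 => /eqP/setP dS.
  exists (ground M :\: b1), (ground N :\: b2); rewrite !imset_f //; split=> //.
  by apply/subsetP => x; apply/implyP; move: (dS x); by_membership x.
case=> _ [_ [/imsetP[b1 b1M ->] /imsetP[b2 b2N ->]]] sS.
exists b1, b2; split=> //; rewrite -setI_eq0.
by apply/eqP/setP => x; move: (subset_implyb x sS); by_membership x.
Qed.

Lemma mwedge_dual M N : is_matroid M -> is_matroid N ->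
  mwedge M N = dual (mvee (dual M) (dual N)).
Proof.
move=> [_ sM _] [_ sN _]; rewrite /mwedge /inter_same [RHS]/dual.
congr BaseSystem; set S := ground (mvee _ _).
have inS x : x \in S = (x \in ground M) || (x \in ground N).
  by rewrite /S ground_mvee inE.
rewrite (@minset_complements S) => [|Y /imset2P[X1 X2 /imset2P[b1 e1 b1M /set1P-> ->]]]; last first.
  case/imset2P=> b2 e2 b2N /set1P -> -> ->; apply/subsetP => x; rewrite inS; apply/implyP.
  by move: (subset_implyb x (sM _ b1M)); by_membership x.
rewrite bases_mvee.
set F := [set b1 :&: b2 | b1 in bases (direct_sum M _), b2 in bases (direct_sum N _)].
suff -> : [set S :\: Y | Y in F]
    = [set b1 :|: b2 | b1 in bases (dual M), b2 in bases (dual N)] by [].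
(* The free summands disappear in the complement. *)
have compl b1 b2 : b1 \in bases M -> b2 \in bases N ->
    S :\: ((b1 :|: (ground N :\: ground M)) :&: (b2 :|: (ground M :\: ground N)))
      = (ground M :\: b1) :|: (ground N :\: b2).
  move=> /sM s1 /sN s2; apply/setP => x; rewrite in_setD inS.
  by move: (subset_implyb x s1) (subset_implyb x s2); by_membership x.
apply/setP => X; apply/imsetP/imset2P.
  case=> Y /imset2P[X1 X2 /imset2P[b1 e1 b1M /set1P-> ->] /imset2P[b2 e2 b2N /set1P-> ->] ->] ->.
  by exists (ground M :\: b1) (ground N :\: b2); rewrite ?imset_f ?compl.
case=> _ _ /imsetP[b1 b1M ->] /imsetP[b2 b2N ->] ->.
by exists ((b1 :|: (ground N :\: ground M)) :&: (b2 :|: (ground M :\: ground N)));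
  rewrite ?compl // !imset2_f ?inE.
Qed.

(** * Rigidity against a direct sum *)

Lemma mvee_disjoint_base M N b1 b2 : is_matroid M -> is_matroid N ->
  b1 \in bases M -> b2 \in bases N -> [disjoint b1 & b2] ->
  b1 :|: b2 \in bases (mvee M N).
Proof.
move=> matM matN b1M b2N d12.
have /indepP[c cMN sc] : indep (mvee M N) (b1 :|: b2) by apply/indep_mveeP; exists b1, b2.
have [c1 [c2 [c1M c2N ec]]] := mvee_base_split cMN.
suff -> : b1 :|: b2 = c by [].
apply/eqP; rewrite eqEcard sc /= cardsU (disjoint_setI0 d12) cards0 subn0.
by rewrite (card_bases matM b1M c1M) (card_bases matN b2N c2N) ec cardsU leq_subr.
Qed.

(** By equicardinality in the union matroid, every base has the size of a disjoint
    union of two bases, hence is one. *)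
Lemma mvee_base_disjoint M N c : is_matroid M -> is_matroid N ->
  zero_intersection M N -> c \in bases (mvee M N) ->
  exists b1 b2, [/\ b1 \in bases M, b2 \in bases N, c = b1 :|: b2 & [disjoint b1 & b2]].
Proof.
move=> matM matN /zero_intersectionP[a1 [a2 [a1M a2N dis]]] cMN.
have [_ sM _] := matM; have [_ sN _] := matN.
have d12 : [disjoint a1 & a2].
  have s12 : a1 :&: a2 \subset ground M :&: ground N by rewrite setISS ?sM ?sN.
  by rewrite -setI_eq0 -(setIidPr s12) setI_eq0.
have [b1 [b2 [b1M b2N ec]]] := mvee_base_split cMN.
exists b1, b2; split=> //.
have := card_bases (mvee_matroid matM matN) cMN (mvee_disjoint_base matM matN a1M a2N d12).
rewrite ec => card_eq; rewrite -setI_eq0 -cards_eq0 -(eqn_add2l #|b1 :|: b2|) addn0.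
rewrite cardsUI card_eq (card_bases matM b1M a1M) (card_bases matN b2N a2N).
by rewrite -cardsUI (disjoint_setI0 d12) cards0 addn0.
Qed.

(** The bases of the union are the disjoint unions of a base b of M and a base n
    of N; avoiding a base k of K amounts to b avoiding k, because n does so
    anyway. *)
Lemma zero_intersection_mvee M N K :
  is_matroid M -> is_matroid N -> is_matroid K -> [disjoint ground K & ground N] ->
  zero_intersection M N ->
  zero_intersection (mvee M N) K <-> zero_intersection M (direct_sum K N).
Proof.
move=> matM matN matK dKN zMN.
have [_ sM _] := matM; have [_ sN _] := matN; have [_ sK _] := matK.
rewrite !zero_intersectionP; split=> [[c [k [cMN kK]]]|[b [_ [bM /imset2P[k n kK nN ->]]]]].
  have [b [n [bM nN -> dbn]]] := mvee_base_disjoint matM matN zMN cMN.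
  rewrite ground_mvee -!setI_eq0 => /eqP/setP e.
  exists b, (k :|: n); rewrite imset2_f //; split=> //.
  rewrite -setI_eq0; apply/eqP/setP => x; move: (e x) (disjoint_setI0 dbn) => /[swap] /setP/(_ x).
  by move: (subset_implyb x (sK _ kK)); by_membership x.
rewrite -!setI_eq0 => /eqP/setP e; exists (b :|: n), k; split=> //.
  apply: mvee_disjoint_base => //; rewrite -setI_eq0; apply/eqP/setP => x; move: (e x).
  move: (subset_implyb x (sM _ bM)) (subset_implyb x (sN _ nN)).
  by_membership x.
rewrite -setI_eq0 ground_mvee; apply/eqP/setP => x; move: (e x) (disjoint_implyb x dKN).
move: (subset_implyb x (sM _ bM)) (subset_implyb x (sN _ nN)).
by_membership x.
Qed.

Lemma full_sum_mwedge M N K :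
  is_matroid M -> is_matroid N -> is_matroid K -> [disjoint ground K & ground N] ->
  full_sum M N -> full_sum (mwedge M N) K <-> full_sum M (direct_sum K N).
Proof.
move=> matM matN matK dKN; rewrite !full_sum_dual mwedge_dual // dual_direct_sum //.
have [matM' matN' matK'] := And3 (dual_matroid matM) (dual_matroid matN) (dual_matroid matK).
rewrite dualK; last by case: (mvee_matroid matM' matN').
exact: zero_intersection_mvee.
Qed.

(** Any base can be changed into one containing the contracted independent set
    without enlarging its trace on S, and the bases containing it all have
    traces of the same, smallest size. *)
Lemma contract_indep_base M S d : is_matroid M -> S \subset ground M ->
  indep M (ground M :\: S) ->
  d \in bases (contract M S) <->
  exists b, [/\ b \in bases M, ground M :\: S \subset b & d = b :&: S].
Proof.
move=> matM sSM ind; have [_ sM _] := matM.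
rewrite bases_contract // inE; split=> [/minsetP[/imsetP[b bM ->] minb]|].
  have [b' [b'M sb' s'b]] := base_extend matM ind bM.
  exists b'; split=> //; apply/esym/minb; first exact: imset_f.
  apply/subsetP => x; rewrite !inE => /andP[xb' xS]; rewrite xS andbT.
  by have := subsetP s'b x xb'; rewrite !inE xS.
case=> b [bM sb ->]; apply/minsetP; split=> [|_ /imsetP[a aM ->] sab]; first exact: imset_f.
apply/eqP; rewrite eqEcard sab /= -(leq_add2r #|b :\: S|) cardsID (card_bases matM bM aM).
rewrite -(cardsID S a) leq_add2l subset_leq_card //.
apply: subset_trans (setSD S (sM _ aM)) _.
by have := setSD S sb; rewrite setDDl setUid.
Qed.

(** Being disjoint passes to smaller sets, and each trace of a base contains a
    minimal one. *)
Lemma zero_intersection_contract M S K :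
  S \subset ground M -> ground M :&: ground K \subset S ->
  zero_intersection (contract M S) K <-> zero_intersection M K.
Proof.
move=> sSM sS; have eS : S :&: ground K = ground M :&: ground K.
  by apply/setP => x; move: (subset_implyb x sSM) (subset_implyb x sS);
    by_membership x.
rewrite !zero_intersectionP eS; split=> -[b [k [bM kK dis]]].
  have [a aM eb] := contract_base_trace sSM bM.
  exists a, k; split=> //; move: dis; rewrite eb -!setI_eq0 => /eqP/setP e.
  by apply/eqP/setP => x; move: (e x) (subset_implyb x sS); by_membership x.
have [d dM sd] := contract_below sSM bM; exists d, k; split=> //.
apply: disjointWr dis; apply: setSI.
by apply: subset_trans sd _; apply: subsetIl.
Qed.

(** In the union matroid the common ground set is independent, so a base of the
    link is a base c of the union without that set; c is b + n for
    bases of M and N, and c covers the common ground set.  Conversely, extend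
    the union of the given b and n, which already contains it, to a base. *)
Lemma full_sum_link M N K :
  is_matroid M -> is_matroid N -> is_matroid K -> [disjoint ground K & ground N] ->
  full_sum M N -> full_sum (link M N) K <-> full_sum M (direct_sum K N).
Proof.
move=> matM matN matK dKN fMN.
have [_ sK _] := matK.
rewrite /link; set S := _ :|: _.
have sS : S \subset ground (mvee M N).
  by rewrite ground_mvee; apply/subsetP => x; apply/implyP; rewrite /S; by_membership x.
have eV : ground (mvee M N) :\: S = ground M :&: ground N.
  by rewrite ground_mvee /S; apply/setP => x; by_membership x.
have indV : indep (mvee M N) (ground (mvee M N) :\: S).
  by rewrite eV; apply/indep_mveeP; case/full_sumP: fMN => b [n [? ? ?]]; exists b, n.
have linkP := contract_indep_base _ (mvee_matroid matM matN) sS indV.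
rewrite !full_sumP; split=> [[d [k [/linkP[c [cMN Vc ->]] kK sd]]]|].
  have [b [n [bM nN ec]]] := mvee_base_split cMN.
  exists b, (k :|: n); split=> //; first exact: imset2_f.
  apply/subsetP => x; apply/implyP; move: (disjoint_implyb x dKN).
  move: (subset_implyb x Vc) (subset_implyb x sd).
  by rewrite eV ec /S /=; by_membership x.
case=> b [_ [bM /imset2P[k n kK nN ->]]] sV.
have /indepP[c cMN sc] : indep (mvee M N) (b :|: n) by apply/indep_mveeP; exists b, n.
exists (c :&: S), k; split=> //.
  apply/linkP; exists c; split=> //; apply: subset_trans sc; rewrite eV.
  apply/subsetP => x; apply/implyP; move: (subset_implyb x sV) (disjoint_implyb x dKN).
  by move: (subset_implyb x (sK _ kK)); by_membership x.
apply/subsetP => x; apply/implyP; move: (subset_implyb x sV) (disjoint_implyb x dKN).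
by move: (subset_implyb x sc); rewrite /S /=; by_membership x.
Qed.

Lemma full_sum_mvee M N K : full_sum M (direct_sum K N) -> [disjoint ground K & ground N] ->
  full_sum (mvee M N) K.
Proof.
move=> /full_sumP[b [_ [bM /imset2P[k n kK nN ->] sV]]] dKN.
have /indepP[c cMN sc] : indep (mvee M N) (b :|: n) by apply/indep_mveeP; exists b, n.
apply/full_sumP; exists c, k; split=> //; rewrite ground_mvee.
apply/subsetP => x; apply/implyP; move: (subset_implyb x sV) (disjoint_implyb x dKN).
by move: (subset_implyb x sc); by_membership x.
Qed.

Lemma zero_intersection_mwedge M N K :
  is_matroid M -> is_matroid N -> is_matroid K -> [disjoint ground K & ground N] ->
  zero_intersection M (direct_sum K N) -> zero_intersection (mwedge M N) K.
Proof.
move=> matM matN matK dKN; rewrite !zero_intersection_dual mwedge_dual // dual_direct_sum //.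
have [matM' matN'] := (dual_matroid matM, dual_matroid matN).
rewrite dualK; last by case: (mvee_matroid matM' matN').
by move=> ?; apply: full_sum_mvee.
Qed.

Lemma full_sum_summand M N K : is_matroid K -> [disjoint ground K & ground N] ->
  full_sum M (direct_sum K N) -> full_sum M N.
Proof.
move=> [_ sK _] dKN /full_sumP[b [_ [bM /imset2P[k n kK nN ->] sV]]].
apply/full_sumP; exists b, n; split=> //.
apply/subsetP => x; apply/implyP; move: (subset_implyb x sV) (disjoint_implyb x dKN).
by move: (subset_implyb x (sK _ kK)); by_membership x.
Qed.

Lemma zero_intersection_summand M N K :
  is_matroid N -> is_matroid K -> [disjoint ground K & ground N] ->
  zero_intersection M (direct_sum K N) -> zero_intersection M N.
Proof.
move=> matN matK dKN; rewrite !zero_intersection_dual dual_direct_sum //.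
by apply: full_sum_summand => //; apply: dual_matroid.
Qed.

End MatroidTheory.

Theorem theorem55 (U : finType) (W T V : {set U})
    (M_WTV M_V M_T : base_system U)
    (disjWT : [disjoint W & T]) (disjWV : [disjoint W & V])
    (disjTV : [disjoint T & V])
    (matM_WTV : is_matroid M_WTV) (matM_V : is_matroid M_V)
    (matM_T : is_matroid M_T)
    (groundM_WTV : ground M_WTV = W :|: T :|: V)
    (groundM_V : ground M_V = V) (groundM_T : ground M_T = T) :
  [/\ rigid M_WTV (direct_sum M_T M_V) <->
        rigid M_WTV M_V /\ rigid (link M_WTV M_V) M_T,
      rigid M_WTV (direct_sum M_T M_V) <->
        [/\ rigid M_WTV M_V,
            full_sum (mwedge M_WTV M_V) M_T
          & zero_intersection (mvee M_WTV M_V) M_T]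
    & rigid M_WTV (direct_sum M_T M_V) <->
        [/\ rigid M_WTV M_V,
            rigid (mwedge M_WTV M_V) M_T
          & rigid (mvee M_WTV M_V) M_T] ].
Proof.
have dTV : [disjoint ground M_T & ground M_V] by rewrite groundM_T groundM_V.
have sE : (ground M_WTV :\: ground M_V) :|: (ground M_V :\: ground M_WTV)
    \subset ground (mvee M_WTV M_V).
  by rewrite ground_mvee; apply/subsetP => x; apply/implyP; by_membership x.
have sT : ground (mvee M_WTV M_V) :&: ground M_T
    \subset (ground M_WTV :\: ground M_V) :|: (ground M_V :\: ground M_WTV).
  rewrite ground_mvee; apply/subsetP => x; apply/implyP.
  by move: (disjoint_implyb x dTV); by_membership x.
have [nM _ _] := matM_WTV; have [nV _ _] := matM_V; have [nT _ _] := matM_T.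
have matvee := mvee_matroid matM_WTV matM_V; have [nvee _ _] := matvee.
have [nwedge _ _] : is_matroid (mwedge M_WTV M_V).
  rewrite mwedge_dual //; apply: dual_matroid.
  by apply: mvee_matroid; apply: dual_matroid.
have nsum : bases (direct_sum M_T M_V) != set0.
  have [/set0Pn[t tT] /set0Pn[v vV]] := (nT, nV).
  by apply/set0Pn; exists (t :|: v); apply: imset2_f.
have nlink : bases (link M_WTV M_V) != set0.
  have /set0Pn[c cM] := nvee; have [d dM _] := contract_below sE cM.
  by apply/set0Pn; exists d.
have fs_summand := full_sum_summand (M := M_WTV) matM_T dTV.
have zi_summand := zero_intersection_summand (M := M_WTV) matM_V matM_T dTV.
have zi_vee := zero_intersection_mvee matM_WTV matM_V matM_T dTV.
have fs_wedge := full_sum_mwedge matM_WTV matM_V matM_T dTV.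
have fs_link := full_sum_link matM_WTV matM_V matM_T dTV.
have zi_link := zero_intersection_contract sE sT.
have fs_vee f := full_sum_mvee (M := M_WTV) f dTV.
have zi_wedge := zero_intersection_mwedge matM_WTV matM_V matM_T dTV.
have rigid_sum := rigidP nM nsum; have rigid_V := rigidP nM nV.
have rigid_link := rigidP nlink nT; have rigid_wedge := rigidP nwedge nT.
have rigid_vee := rigidP nvee nT.
rewrite -/(link M_WTV M_V) in zi_link.
have criterion : rigid M_WTV (direct_sum M_T M_V) <->
    [/\ rigid M_WTV M_V, full_sum (mwedge M_WTV M_V) M_T
      & zero_intersection (mvee M_WTV M_V) M_T].
  split=> [/rigid_sum[f z]|[/rigid_V[fV zV] /(fs_wedge fV) f /(zi_vee zV) z]].
    have [fV zV] := (fs_summand f, zi_summand z).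
    by split; [apply/rigid_V|apply/(fs_wedge fV)|apply/(zi_vee zV)].
  exact/rigid_sum.
split=> //.
  split=> [rig|[/[dup] rV /rigid_V[fV zV] /rigid_link[/(fs_link fV) f /zi_link z]]].
    have [rV _ zv] := criterion.1 rig; split=> //; apply/rigid_link.
    have [fV _] := rigid_V.1 rV; have [f _] := rigid_sum.1 rig.
    by split; [apply/(fs_link fV)|apply/zi_link].
  by apply/rigid_sum; split=> //; apply/(zi_vee zV).
split=> [rig|[rV /rigid_wedge[f _] /rigid_vee[_ z]]]; last exact/criterion.
have [rV fw zv] := criterion.1 rig; have [f z] := rigid_sum.1 rig.
by split=> //; [apply/rigid_wedge; split=> //; apply: zi_wedge
               |apply/rigid_vee; split=> //; apply: fs_vee].
Qed.
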